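(* Consider the single stage pricing game with additive loyalty described in the context, with parameters $c_A\ge c_B\ge 0$, $s_\alpha,s_\beta\ge0$, $\theta\in(0,1)$, and $F$ the distribution function of the uniform distribution on $[0,1]$. Suppose (Region I) $$1-s_\beta\le c_A-c_B\le s_\alpha-1 .$$ Then the game has a unique pure Nash equilibrium, and its prices are $$p_A^\alpha=c_B+s_\alpha,\quad p_A^\beta=c_A,\quad p_B^\beta=c_A+s_\beta,\quad p_B^\alpha=c_B .$$
   Context: Two firms $A$ and $B$ sell the same product, with unit product costs $c_A$ and $c_B$, where $c_A\ge c_B\ge 0$. Customers are partitioned into a set $\alpha$ (ex ante loyal to $A$; a fraction $\theta$ of the market) and a set $\beta$ (ex ante loyal to $B$; a fraction $1-\theta$). Both firms can tell the two sets apart. Each customer buys exactly one unit, from $A$ or from $B$. Firms move simultaneously: $A$ chooses $(p_A^\alpha,p_A^\beta)$ with $p_A^\alpha,p_A^\beta\ge c_A$, and $B$ chooses $(p_B^\beta,p_B^\alpha)$ with $p_B^\beta,p_B^\alpha\ge c_B$; the superscript is the set of customers to which the price is offered. Additive loyalty: a customer in $\alpha$ has loyalty level $\xi+s_\alpha$ and buys from $A$ iff $\xi+s_\alpha\ge p_A^\alpha-p_B^\alpha$; a customer in $\beta$ has loyalty level $\xi+s_\beta$ and buys from $B$ iff $\xi+s_\beta\ge p_B^\beta-p_A^\beta$; here $\xi$ is random with distribution function $F$. Put $\xi^\alpha=p_A^\alpha-p_B^\alpha-s_\alpha$ and $\xi^\beta=p_B^\beta-p_A^\beta-s_\beta$.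 For the uniform distribution, $F(x)=0$ for $x\le 0$, $F(x)=x$ for $0\le x\le1$, $F(x)=1$ for $x\ge1$. Profits: firm $A$ gets $(p_A^\alpha-c_A)\,\theta\,(1-F(\xi^\alpha))+(p_A^\beta-c_A)(1-\theta)F(\xi^\beta)$; firm $B$ gets $(p_B^\beta-c_B)(1-\theta)(1-F(\xi^\beta))+(p_B^\alpha-c_B)\,\theta\,F(\xi^\alpha)$. A pure Nash equilibrium is a price profile $(p_A^\alpha,p_A^\beta,p_B^\beta,p_B^\alpha)$ from which neither firm can strictly increase its profit by unilaterally changing its own (feasible) prices. *)

(* Defs.v *)
From HB Require Import structures.
From mathcomp Require Import all_boot all_order all_algebra.
From mathcomp Require Import reals.
Set Implicit Arguments.
Unset Strict Implicit.
Unset Printing Implicit Defensive.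
Import Order.TTheory GRing.Theory Num.Theory.
Local Open Scope ring_scope.

(* [theta] is the fraction of customers ex ante loyal to A (the set alpha);
   [F] is the distribution function of the random part xi of the loyalty. *)
Record game (R : realType) := Game {
  cA : R;
  cB : R;
  s_alpha : R;
  s_beta : R;
  theta : R;
  F : R -> R
}.

(* The letter names the firm, the suffix the set of customers that is offered
   the price. *)
Record profile (R : realType) := Profile {
  pA_alpha : R;
  pA_beta : R;
  pB_beta : R;
  pB_alpha : R
}.

Section Pricing.
Context {R : realType}.
Implicit Types (g : game R) (p : profile R).

Definition uniform_cdf (x : R) : R :=
  if x <= 0 then 0 else if x <= 1 then x else 1.

(* A customer of alpha leaves A iff xi < xi_alpha, and a customer of beta
   leaves B iff xi < xi_beta. *)
Definition xi_alpha g p : R := pA_alpha p - pB_alpha p - s_alpha g.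
Definition xi_beta g p : R := pB_beta p - pA_beta p - s_beta g.

Definition profitA g p : R :=
  (pA_alpha p - cA g) * theta g * (1 - F g (xi_alpha g p))
  + (pA_beta p - cA g) * (1 - theta g) * F g (xi_beta g p).

Definition profitB g p : R :=
  (pB_beta p - cB g) * (1 - theta g) * (1 - F g (xi_beta g p))
  + (pB_alpha p - cB g) * theta g * F g (xi_alpha g p).

Definition feasibleA g p : Prop := cA g <= pA_alpha p /\ cA g <= pA_beta p.
Definition feasibleB g p : Prop := cB g <= pB_beta p /\ cB g <= pB_alpha p.

Definition deviateA p (a_alpha a_beta : R) : profile R :=
  Profile a_alpha a_beta (pB_beta p) (pB_alpha p).
Definition deviateB p (b_beta b_alpha : R) : profile R :=
  Profile (pA_alpha p) (pA_beta p) b_beta b_alpha.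

Definition pure_nash g p : Prop :=
  [/\ feasibleA g p,
      feasibleB g p,
      forall a_alpha a_beta : R,
        let q := deviateA p a_alpha a_beta in
        feasibleA g q -> profitA g q <= profitA g p
    & forall b_beta b_alpha : R,
        let q := deviateB p b_beta b_alpha in
        feasibleB g q -> profitB g q <= profitB g p].

End Pricing.

(* Main.v *)
(* The two sets of customers are separate markets, in each of which the firm to
   which the customers are loyal (the incumbent, cost [cI], price [x]) faces an
   entrant (cost [cE], price [y]). Region I says that in both markets the
   incumbent's advantage [cE + s - cI] is at least the length of the support of
   the loyalty noise. The incumbent's strict best reply to [y] is then [y + s],
   the highest price at which it loses no customer; and the entrant, having no
   customer, would undercut slightly unless its price is already its cost. *)

Require Import Defs.
From HB Require Import structures.
From mathcomp Require Import all_boot all_order all_algebra.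
From mathcomp Require Import reals ring lra.
Set Implicit Arguments.
Unset Strict Implicit.
Unset Printing Implicit Defensive.
Import Order.TTheory GRing.Theory Num.Theory.
Local Open Scope ring_scope.

Section Market.
Context {R : realType}.
Implicit Types (F : R -> R) (cI cE s x y t M : R).

Definition incumbent_profit F cI s x y := (x - cI) * (1 - F (x - y - s)).
Definition entrant_profit F cE s x y := (y - cE) * F (x - y - s).

Definition market_nash F cI cE s x y : Prop :=
  [/\ cI <= x, cE <= y,
      forall x', cI <= x' ->
        incumbent_profit F cI s x' y <= incumbent_profit F cI s x y
    & forall y', cE <= y' ->
        entrant_profit F cE s x y' <= entrant_profit F cE s x y].

(** Each profit is a sum of one term per market, with positive weights [th] and [1 - th]. Changing
    one price cancels the other market's term, and conversely the two market inequalities add up. *)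
Lemma pure_nash_markets F (c_A c_B s_a s_b th : R) (p : profile R) :
  0 < th < 1 ->
  pure_nash (Game c_A c_B s_a s_b th F) p <->
  market_nash F c_A c_B s_a (pA_alpha p) (pB_alpha p) /\
  market_nash F c_B c_A s_b (pB_beta p) (pA_beta p).
Proof.
case/andP=> th0 th1; have th1' : 0 < 1 - th by rewrite subr_gt0.
case: p => aa ab bb ba.
rewrite /pure_nash /market_nash /feasibleA /feasibleB /profitA /profitB.
rewrite /xi_alpha /xi_beta /incumbent_profit /entrant_profit /=.
split.
- case=> -[Haa Hab] [Hbb Hba] HA HB; split; split=> // z Hz.
  + by have := HA z ab (conj Hz Hab); rewrite lerD2r 2!(mulrAC _ th) ler_pM2r.
  + by have := HB bb z (conj Hbb Hz); rewrite lerD2l 2!(mulrAC _ th) ler_pM2r.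
  + have := HB z ba (conj Hz Hba).
    by rewrite lerD2r 2!(mulrAC _ (1 - th)) ler_pM2r.
  + have := HA aa z (conj Haa Hz).
    by rewrite lerD2l 2!(mulrAC _ (1 - th)) ler_pM2r.
- case=> -[Haa Hba Haa' Hba'] [Hbb Hab Hbb' Hab']; split=> // y z [Hy Hz].
  + by apply: lerD; rewrite ?(mulrAC _ th)
      ?(mulrAC _ (1 - th)) ler_pM2r //; auto.
  + by apply: lerD; rewrite ?(mulrAC _ th) ?(mulrAC _ (1 - th)) ler_pM2r //;
      auto.
Qed.

Lemma uniform_cdf_le0 t : t <= 0 -> uniform_cdf t = 0.
Proof. by rewrite /uniform_cdf => ->. Qed.

Lemma uniform_cdf_gt0 t : 0 < t -> 0 < uniform_cdf t.
Proof. by move=> t0; rewrite /uniform_cdf leNgt t0 /=; case: ifP. Qed.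

(** [M] is the margin at the highest price that loses nobody, [t] the deviation from that price. If
    [t < 0], margin is given away for no customers. If [0 < t <= 1], the product is
    [M - t * (M - 1) - t * t]. Beyond 1 all customers are lost. *)
Lemma margin_times_share_lt M t :
  1 <= M -> t != 0 -> (M + t) * (1 - uniform_cdf t) < M.
Proof.
rewrite /uniform_cdf => M1 tN0.
case: (ltgtP t 0) tN0 => //= t0 _; first by lra.
case: (leP t 1) => t1; last by lra.
have ? : 0 <= t * (M - 1) by apply: mulr_ge0; lra.
have ? : 0 < t * t by apply: mulr_gt0.
lra.
Qed.

Lemma uniform_market_nashP cI cE s x y : 1 <= cE + s - cI ->
  market_nash uniform_cdf cI cE s x y <-> x = cE + s /\ y = cE.
Proof.
move=> M1; rewrite /market_nash /incumbent_profit /entrant_profit.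
have best_reply z y' : cE <= y' -> z - y' - s != 0 ->
    (z - cI) * (1 - uniform_cdf (z - y' - s)) < y' + s - cI.
  move=> Hy' tN0.
  have -> : z - cI = (y' + s - cI) + (z - y' - s) by ring.
  by apply: margin_times_share_lt tN0; lra.
split=> [[Hx Hy HI HE]|[-> ->]]; last first.
  have z0 : cE + s - cE - s = 0 by ring.
  split=> [||z Hz|z Hz]; [lra|lra| |].
  - rewrite z0 [X in _ <= _ * (1 - X)]uniform_cdf_le0 // subr0 mulr1.
    have [t0|tN0] := eqVneq (z - cE - s) 0.
      by rewrite t0 uniform_cdf_le0 //; lra.
    by apply: ltW; apply: best_reply.
  - rewrite subrr mul0r uniform_cdf_le0 ?mulr0 //; lra.
have xE : x = y + s.
  have [t0|tN0] := eqVneq (x - y - s) 0; first by lra.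
  (* The candidate deviation is feasible: [y >= cE] and the advantage is at least 1. *)
  have HIys : cI <= y + s by lra.
  have := HI _ HIys; have := best_reply _ _ Hy tN0.
  have -> : y + s - y - s = 0 by ring.
  by rewrite (uniform_cdf_le0 (lexx 0)); lra.
suff yE : y = cE by rewrite xE yE.
apply/eqP; rewrite eq_le Hy andbT leNgt; apply/negP => y_gt.
(* At [x = y + s] the entrant sells nothing. Any price strictly between [cE] and [y] gives it both a
   positive margin and a positive share; the midpoint is one. *)
have Hmid : cE <= (y + cE) / 2 by lra.
have := HE _ Hmid; rewrite {}xE.
have -> : y + s - y - s = 0 by ring.
rewrite (uniform_cdf_le0 (lexx 0)) mulr0 leNgt => /negP; apply.
by apply: mulr_gt0; [lra | apply: uniform_cdf_gt0; lra].
Qed.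

End Market.

Theorem proposition15 (R : realType) (c_A c_B s_a s_b th : R)
    (hcB : 0 <= c_B) (hcA : c_B <= c_A)
    (hsa : 0 <= s_a) (hsb : 0 <= s_b)
    (hth : 0 < th < 1)
    (hregion : 1 - s_b <= c_A - c_B <= s_a - 1) :
  unique (pure_nash (Game c_A c_B s_a s_b th uniform_cdf))
    {| pA_alpha := c_B + s_a;
       pA_beta := c_A;
       pB_beta := c_A + s_b;
       pB_alpha := c_B |}.
Proof.
have /andP[Hb Ha] := hregion.
(* The upper bound of the region serves [alpha], where A is the incumbent, and the lower bound
   serves [beta], where the roles are swapped. *)
have Ma : 1 <= c_B + s_a - c_A by lra.
have Mb : 1 <= c_A + s_b - c_B by lra.
split.
  by apply/(pure_nash_markets _ _ _ _ _ _ hth); split;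
    apply/uniform_market_nashP.
case=> aa ab bb ba /(pure_nash_markets _ _ _ _ _ _ hth) /=.
by case=> /(uniform_market_nashP _ _ Ma)[-> ->]
  /(uniform_market_nashP _ _ Mb)[-> ->].
Qed.
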